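(* For any positive integer $j$, every Hausdorff shift-continuous topology $\tau$ on $\mathbf{I}\mathbb{N}_{\infty}^{\boldsymbol{g}[j]}$ is discrete.
   Context: $\mathbb{N}$ is the set of positive integers with the metric $|n-m|$ and $[n)=\{m\in\mathbb{N}\colon m\geqslant n\}$. Partial maps are written on the right and composed left to right: $x(\gamma\delta)=(x\gamma)\delta$, with $\operatorname{dom}(\gamma\delta)=\{x\in\operatorname{dom}\gamma\colon x\gamma\in\operatorname{dom}\delta\}$. $\mathbf{I}\mathbb{N}_{\infty}$ is the inverse monoid (under composition) of all partial isometries $\gamma\colon\mathbb{N}\rightharpoonup\mathbb{N}$ (i.e. $|x\gamma-y\gamma|=|x-y|$ for all $x,y\in\operatorname{dom}\gamma$) which are cofinite, i.e. $\mathbb{N}\setminus\operatorname{dom}\gamma$ and $\mathbb{N}\setminus\operatorname{ran}\gamma$ are finite. $\mathscr{C}_{\mathbb{N}}$ is its submonoid generated by $\alpha\colon n\mapsto n+1$ ($\operatorname{dom}\alpha=\mathbb{N}$) and $\beta\colon n\mapsto n-1$ ($\operatorname{dom}\beta=\mathbb{N}\setminus\{1\}$); it is isomorphic to the bicyclic monoid. For $\gamma\in\mathbf{I}\mathbb{N}_{\infty}$, $\underline{n}_{\gamma}^{\mathbf{d}}=\min\operatorname{dom}\gamma$, and $n_{\gamma}^{\mathbf{d}}$ is the smallest $n\in\operatorname{dom}\gamma$ such that the restriction $\gamma|_{[n)}$ belongs to $\mathscr{C}_{\mathbb{N}}$ (i.e. $[n)\subseteq\operatorname{dom}\gamma$ and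 $\gamma$ is a shift on $[n)$). For a non-negative integer $j$, $\mathbf{I}\mathbb{N}_{\infty}^{\boldsymbol{g}[j]}=\{\gamma\in\mathbf{I}\mathbb{N}_{\infty}\colon n_{\gamma}^{\mathbf{d}}-\underline{n}_{\gamma}^{\mathbf{d}}\leqslant j\}$, which is an inverse submonoid of $\mathbf{I}\mathbb{N}_{\infty}$. A topology on a semigroup is shift-continuous if the semigroup operation is separately continuous, i.e. all left and right translations are continuous. *)

(* Defs.v *)
From HB Require Import structures.
From mathcomp Require Import all_boot all_order ssralg ssrint zify.
From mathcomp Require Import all_classical.
From mathcomp Require Import topology.

Set Implicit Arguments.
Unset Strict Implicit.
Unset Printing Implicit Defensive.

Local Open Scope classical_set_scope.

Record posnat := PosNat { pnat : nat; pnat_gt0 : 0 < pnat }.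

HB.instance Definition _ := [isSub for pnat].
HB.instance Definition _ := [Choice of posnat by <:].

Definition pmap : Type := posnat -> option posnat.

HB.instance Definition _ := Choice.on pmap.

(* Maps are written on the right: x (g d) = (x g) d. *)
Definition pcomp (g d : pmap) : pmap := fun x => obind d (g x).

Definition pid : pmap := fun x => Some x.

Lemma pcompA : associative pcomp.
Proof. by move=> f g h; apply/funext => x; rewrite /pcomp; case: (f x). Qed.

Lemma pcomp1g : left_id pid pcomp.
Proof. by []. Qed.

Lemma pcompg1 : right_id pid pcomp.
Proof. by move=> f; apply/funext => x; rewrite /pcomp; case: (f x). Qed.

HB.instance Definition _ := isMonoid.Build pmap pcompA pcomp1g pcompg1.

Definition pdom (g : pmap) : set posnat := [set x | isSome (g x)].

Definition pran (g : pmap) : set posnat := [set y | exists x, g x = Some y].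

Definition partial_isometry (g : pmap) : Prop :=
  forall x y x' y', g x = Some x' -> g y = Some y' ->
    `|(pnat x' - pnat y')|%N = `|(pnat x - pnat y)|%N.

Definition IN_infty : set pmap :=
  [set g | [/\ partial_isometry g, finite_set (~` pdom g)
             & finite_set (~` pran g)]].

Definition alpha : pmap := fun n => Some (PosNat (ltn0Sn (pnat n))).

(* [insub] yields [None] when the predecessor is not positive. *)
Definition beta : pmap := fun n => insub (pnat n).-1.

Inductive C_N : set pmap :=
| C_N_one : C_N 1%g
| C_N_alpha : C_N alpha
| C_N_beta : C_N beta
| C_N_mul g d : C_N g -> C_N d -> C_N (g * d)%g.

Definition restr_ray (g : pmap) (n : posnat) : pmap :=
  fun m => if pnat n <= pnat m then g m else None.

Definition is_min (A : set posnat) (n : posnat) : Prop :=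
  A n /\ forall m, A m -> pnat n <= pnat m.

(* The value [1] is junk, taken only when [A] is empty. *)
Definition min_set (A : set posnat) : posnat :=
  xget (PosNat (ltn0Sn 0)) (is_min A).

Definition n_low (g : pmap) : posnat := min_set (pdom g).

Definition n_d (g : pmap) : posnat :=
  min_set [set n | pdom g n /\ C_N (restr_ray g n)].

(* Truncated subtraction is harmless here: [n_low g <= n_d g] on [IN_infty]. *)
Definition IN_g_set (j : nat) : set pmap :=
  [set g | IN_infty g /\ pnat (n_d g) - pnat (n_low g) <= j].

Lemma min_setP (A : set posnat) : A !=set0 -> is_min A (min_set A).
Proof.
move=> [x Ax]; apply: xgetPex.
have ex : exists k, `[< exists2 y, A y & pnat y = k >].
  by exists (pnat x); apply/asboolP; exists x.
have := ex_minnP ex; case=> k /asboolP[y Ay yk] kmin.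
exists y; split=> // m Am; rewrite yk; apply: kmin.
by apply/asboolP; exists m.
Qed.

Lemma cofinite_ray (A : set posnat) : finite_set (~` A) ->
  exists N, forall x : posnat, N <= pnat x -> A x.
Proof.
move=> /finite_seqP[s sE].
exists (\max_(y <- s) pnat y).+1 => x lex.
apply: contrapT => nAx.
have xs : x \in s by have : (~` A) x by []; rewrite sE.
have := @leq_bigmax_seq _ s xpredT (fun y => pnat y) x xs isT.
by move=> /= h; move: (leq_trans lex h); rewrite ltnn.
Qed.

Lemma isometry_shift g : partial_isometry g ->
  forall N : nat, (forall x : posnat, N <= pnat x -> pdom g x) ->
  exists c d : nat, forall x y, g x = Some y -> pnat y + d = pnat x + c.
Proof.
move=> iso N domN.
have dm k : exists y, g (PosNat (ltn0Sn (N + k))) = Some y.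
  have : pdom g (PosNat (ltn0Sn (N + k))) by apply: domN => /=; lia.
  by rewrite /pdom /=; case: (g _) => // y _; exists y.
have [y0 E0] := dm 0.
exists (pnat y0), (N + 0).+1 => x y xy.
have [y1 E1] := dm (pnat x + pnat y + pnat y0 + N + 1).
have := iso _ _ _ _ E1 E0; have := iso _ _ _ _ xy E0.
have := iso _ _ _ _ xy E1; rewrite /=; lia.
Qed.

Lemma C_N_ray g : C_N g -> forall x y : posnat, pnat x <= pnat y ->
  pdom g x -> pdom g y /\ forall x' y', g x = Some x' -> g y = Some y' ->
    pnat x' <= pnat y'.
Proof.
elim=> [x y xy _|x y xy _|x y xy|{}g d _ IHg _ IHd x y xy].
- by split=> // x' y' [<-] [<-].
- by split=> // x' y' [<-] [<-].
- rewrite /pdom /beta /=; case: insubP => //= u u0 uE _.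
  case: insubP => [v v0 /= vE|]; last by move=> h; lia.
  by split=> // x' y' [<-] [<-]; rewrite uE vE; lia.
- rewrite /pdom /= /mul /= /pcomp.
  have := IHg x y xy; rewrite /pdom /=.
  case: (g x) => [x1|] //= /(_ isT)[]; case: (g y) => [y1|] //= _ /(_ _ _ erefl erefl) le1.
  by move=> dx; apply: IHd.
Qed.

Definition shiftmap (i k : nat) : pmap := fun x =>
  if i < pnat x then insub (pnat x - i + k) else None.

Lemma C_N_shiftmap i k : C_N (shiftmap i k).
Proof.
have val_insub (n : nat) : 0 < n -> exists2 u : posnat, insub n = Some u & pnat u = n.
  by move=> n0; exists (PosNat n0) => //; rewrite insubT.
elim: k => [|k IH].
  elim: i => [|i IH].
    suff -> : shiftmap 0 0 = 1%g by exact: C_N_one.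
    apply/funext=> x; rewrite /shiftmap subn0 addn0 valK.
    by have -> : 0 < pnat x by exact: (pnat_gt0 x).
  suff -> : shiftmap i.+1 0 = (beta * shiftmap i 0)%g by apply: C_N_mul => //; exact: C_N_beta.
  apply/funext=> x; rewrite /mul /= /pcomp /beta.
  case: insubP => [u u0 /= uE|n0].
    rewrite /shiftmap uE; have -> : (i.+1 < pnat x) = (i < (pnat x).-1) by lia.
    by have -> : pnat x - i.+1 + 0 = (pnat x).-1 - i + 0 by lia.
  by rewrite /shiftmap; have -> : (i.+1 < pnat x) = false by lia.
suff -> : shiftmap i k.+1 = (shiftmap i k * alpha)%g by apply: C_N_mul => //; exact: C_N_alpha.
apply/funext=> x; rewrite /mul /= /pcomp /shiftmap.
case: ifP => //= ix.
have [u -> uE] := val_insub (pnat x - i + k) ltac:(lia).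
have [v -> vE] := val_insub (pnat x - i + k.+1) ltac:(lia).
by rewrite /= /alpha; congr Some; apply: val_inj; rewrite /= vE uE addnS.
Qed.

Lemma restr_rayP g n : IN_infty g -> pdom g n ->
  C_N (restr_ray g n) <-> forall m : posnat, pnat n <= pnat m -> pdom g m.
Proof.
move=> [iso /cofinite_ray[N domN] _] gn; split=> [Cg m nm|domn].
  have /= := C_N_ray Cg nm; rewrite /pdom /restr_ray /= leqnn => /(_ gn)[].
  by rewrite nm.
have [c [d cd]] := isometry_shift iso domN.
have nP : 0 < pnat n by exact: (pnat_gt0 n).
have [y gny] : exists y, g n = Some y.
  by move: gn; rewrite /pdom /=; case: (g n) => // y _; exists y.
suff -> : restr_ray g n = shiftmap (pnat n).-1 (pnat y).-1 by exact: C_N_shiftmap.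
apply/funext => x; rewrite /restr_ray /shiftmap.
have -> : ((pnat n).-1 < pnat x) = (pnat n <= pnat x) by lia.
case: ifP => // nx.
have := domn x nx; rewrite /pdom /=; case E: (g x) => [z|] // _.
have := cd _ _ E; have := cd _ _ gny; have yP : 0 < pnat y by exact: (pnat_gt0 y).
move=> e1 e2.
have -> : pnat x - (pnat n).-1 + (pnat y).-1 = pnat z by lia.
by rewrite valK.
Qed.

Lemma pdom_nonempty g : IN_infty g -> pdom g !=set0.
Proof.
move=> [_ /cofinite_ray[N domN] _]; exists (PosNat (ltn0Sn N)).
by apply: domN => /=; lia.
Qed.

Lemma n_lowP g : IN_infty g -> is_min (pdom g) (n_low g).
Proof. by move=> Ig; apply/min_setP/pdom_nonempty. Qed.

Lemma n_dP g : IN_infty g ->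
  is_min [set n | pdom g n /\ C_N (restr_ray g n)] (n_d g).
Proof.
move=> Ig; have [_ /cofinite_ray[N domN] _] := Ig.
apply/min_setP; exists (PosNat (ltn0Sn N)).
have gN : pdom g (PosNat (ltn0Sn N)) by apply: domN => /=; lia.
split=> //; apply/(restr_rayP Ig gN) => m /= Nm; apply: domN; lia.
Qed.

Lemma IN_g_setP j g : IN_infty g -> IN_g_set j g <->
  exists a b : posnat, [/\ forall x, pdom g x -> pnat a <= pnat x,
    forall x : posnat, pnat b <= pnat x -> pdom g x & pnat b <= pnat a + j].
Proof.
move=> Ig; have [[gl lmin] [[gd Cd] dmin]] := (n_lowP Ig, n_dP Ig).
split=> [[_ le]|[a [b [amin bdom ab]]]].
  exists (n_low g), (n_d g); split=> //; last by lia.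
  exact/(restr_rayP Ig gd).
split=> //.
have gb : pdom g b by exact: bdom.
have := dmin b (conj gb ((restr_rayP Ig gb).2 bdom)).
have := amin _ gl; lia.
Qed.

Lemma IN_infty_one : IN_infty 1%g.
Proof.
split.
- by move=> x y x' y' [<-] [<-].
- have -> : ~` pdom 1%g = set0 by rewrite -subset0 => x; apply.
  exact: finite_set0.
- have -> : ~` pran 1%g = set0 by rewrite -subset0 => x; apply; exists x.
  exact: finite_set0.
Qed.

Lemma ray_cofinite (A : set posnat) N :
  (forall x : posnat, N <= pnat x -> A x) -> finite_set (~` A).
Proof.
move=> NA; apply: (@sub_finite_set _ _ (pnat @^-1` `I_N)).
  by move=> x nAx /=; rewrite ltnNge; apply/negP => /NA.
apply: finite_preimage; last exact: finite_II.
by move=> x y _ _; exact: val_inj.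
Qed.

Lemma IN_infty_shift g : IN_infty g ->
  exists c d : nat, forall x y, g x = Some y -> pnat y + d = pnat x + c.
Proof.
move=> [iso /cofinite_ray[N domN] _]; exact: isometry_shift domN.
Qed.

Lemma pcompE (g d : pmap) x : (g * d)%g x = obind d (g x).
Proof. by []. Qed.

Lemma IN_infty_mul g d : IN_infty g -> IN_infty d -> IN_infty (g * d)%g.
Proof.
move=> Ig Id; have [c [e ce]] := IN_infty_shift Ig.
have [c' [e' ce']] := IN_infty_shift Id.
have [isog /cofinite_ray[N Ndom] /cofinite_ray[M Mran]] := Ig.
have [isod /cofinite_ray[N' Ndom'] /cofinite_ray[M' Mran']] := Id.
split.
- move=> x y x' y'; rewrite !pcompE.
  case gx: (g x) => [x1|] //= dx; case gy: (g y) => [y1|] //= dy.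
  by rewrite (isod _ _ _ _ dx dy) (isog _ _ _ _ gx gy).
- apply: (@ray_cofinite _ (N + N' + e)) => x lex.
  have := Ndom x ltac:(lia); rewrite /pdom /= pcompE; case gx: (g x) => [y|] //= _.
  by apply: Ndom'; have := ce _ _ gx; lia.
- apply: (@ray_cofinite _ (M' + M + c')) => z lez.
  have [y dy] := Mran' z ltac:(lia).
  have [x gx] := Mran y ltac:(have := ce' _ _ dy; lia).
  by exists x; rewrite pcompE gx.
Qed.

Lemma IN_g_set_one j : IN_g_set j 1%g.
Proof.
apply/(IN_g_setP j IN_infty_one).
exists (PosNat (ltn0Sn 0)), (PosNat (ltn0Sn 0)); split=> //= x _; exact: pnat_gt0.
Qed.

Lemma IN_g_set_mul j g d :
  IN_g_set j g -> IN_g_set j d -> IN_g_set j (g * d)%g.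
Proof.
move=> Sg Sd; have [Ig _] := Sg; have [Id _] := Sd.
have [a [b [amin bdom ab]]] := (IN_g_setP j Ig).1 Sg.
have [a' [b' [amin' bdom' ab']]] := (IN_g_setP j Id).1 Sd.
have [c [e ce]] := IN_infty_shift Ig.
apply/(IN_g_setP j (IN_infty_mul Ig Id)).
have aP : 0 < pnat a by exact: (pnat_gt0 a).
have bP : 0 < pnat b by exact: (pnat_gt0 b).
have PA : 0 < maxn (pnat a) (pnat a' + e - c) by lia.
have PB : 0 < maxn (pnat b) (pnat b' + e - c) by lia.
exists (PosNat PA), (PosNat PB); split=> /=; last by lia.
- move=> x; rewrite /pdom /= pcompE.
  case gx: (g x) => [y|] //= dy.
  have gxd : pdom g x by rewrite /pdom /= gx.
  have := amin _ gxd; have := amin' _ dy; have := ce _ _ gx; lia.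
- move=> x lex; rewrite /pdom /= pcompE.
  have := bdom x ltac:(lia); rewrite /pdom /=; case gx: (g x) => [y|] //= _.
  by apply: bdom'; have := ce _ _ gx; lia.
Qed.

Definition IN_g (j : nat) : Type := set_type (IN_g_set j).

HB.instance Definition _ j := SubChoice.on (IN_g j).

Definition IN_g_one j : IN_g j := SigSub (mem_set (IN_g_set_one j)).

Definition IN_g_mul j (g d : IN_g j) : IN_g j :=
  SigSub (mem_set (IN_g_set_mul (set_valP g) (set_valP d))).

Lemma IN_g_mulA j : associative (@IN_g_mul j).
Proof. by move=> f g h; apply: val_inj; exact: mulgA. Qed.

Lemma IN_g_mul1g j : left_id (IN_g_one j) (@IN_g_mul j).
Proof. by move=> g; apply: val_inj; exact: mul1g. Qed.

Lemma IN_g_mulg1 j : right_id (IN_g_one j) (@IN_g_mul j).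
Proof. by move=> g; apply: val_inj; exact: mulg1. Qed.

HB.instance Definition _ j :=
  isMonoid.Build (IN_g j) (@IN_g_mulA j) (@IN_g_mul1g j) (@IN_g_mulg1 j).

(* A topology on a fixed carrier [S] is a [Topological] class on [S]. The class also carries
   Equality and Choice data, which need not be the canonical ones of [S] and play no role
   in the topological notions. *)
Definition hausdorff_topology (S : Type) (tau : Topological.axioms_ S) : Prop :=
  hausdorff_space (Topological.Pack tau).

Definition discrete (S : Type) (tau : Topological.axioms_ S) : Prop :=
  forall A : set (Topological.Pack tau), open A.

Definition shift_continuous (S : semigroupType) (tau : Topological.axioms_ S) : Prop :=
  let T : topologicalType := Topological.Pack tau in
  forall a : S,
    continuous ((fun x : S => (a * x)%g) : T -> T) /\
    continuous ((fun x : S => (x * a)%g) : T -> T).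

(* Main.v *)
From mathcomp Require Import all_boot zify all_classical topology.
Require Import Defs.

(** Given a positive integer [n], let [e] be the identity map of the ray
    {n, n + 1, ...}. The sets [{g | e g = g}] and [{g | g e = g}] are closed, so
    the set [U] of those [g] with [e g <> g] and [g e <> g] is open. Now [g]
    lies in [U] iff both its domain and its range contain an element below [n]:
    this bounds its shift, and the gap condition places every integer from
    [n + j] on in its domain, so [U] is finite. A finite open set of a Hausdorff
    space consists of isolated points, and every [g] lies in [U] for [n] large
    enough. *)

Set Implicit Arguments.
Unset Strict Implicit.
Unset Printing Implicit Defensive.

Local Open Scope classical_set_scope.

(** Disjoint open neighbourhoods of [f x] and [g x] pull back to a neighbourhood of [x] on which [f]
    and [g] cannot agree. *)
Lemma open_neq (X Y : topologicalType) (f g : X -> Y) :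
  hausdorff_space Y -> continuous f -> continuous g ->
  open [set x | f x <> g x].
Proof.
rewrite open_hausdorff => hY cf cg; rewrite openE => x /= /eqP fgx.
have [[A B] /= [/set_mem Afx /set_mem Bgx] [oA oB /eqP AB0]] := hY _ _ fgx.
apply: (@filterS _ (nbhs x) _ (f @^-1` A `&` g @^-1` B)) => [y [/= Afy Bgy] fgy|].
  suff : (A `&` B) (f y) by rewrite AB0.
  by split=> //; rewrite fgy.
by apply: filterI; [apply: cf|apply: cg]; apply: open_nbhs_nbhs.
Qed.

(** The rest of [U] is finite, hence closed in a T1 space; removing it from [U] leaves only [x]. *)
Lemma open_finite_set1 (X : topologicalType) (U : set X) (x : X) :
  accessible_space X -> open U -> finite_set U -> U x -> open [set x].
Proof.
move=> aX oU finU Ux.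
have -> : [set x] = U `\` (U `\ x).
  apply/seteqP; split=> [y ->|y [Uy nUy]]; first by split=> [|[_ /(_ erefl)]].
  by apply: contrapT => yx; apply: nUy.
rewrite setDE; apply: openI => //; apply: closed_openC.
apply: (accessible_finite_set_closed.1 aX).
exact: finite_setD.
Qed.

Lemma restr_ray1E n x :
  restr_ray 1%g n x = if pnat n <= pnat x then Some x else None.
Proof. by []. Qed.

Lemma IN_g_set_ray j n : IN_g_set j (restr_ray 1%g n).
Proof.
have dom_n x : pnat n <= pnat x -> restr_ray 1%g n x = Some x.
  by rewrite restr_ray1E => ->.
apply/IN_g_setP.
  split.
  - move=> x y x' y'; rewrite !restr_ray1E.
    by do 2![case: ifP => // _]; move=> [->] [->].
  - by apply: (@ray_cofinite _ (pnat n)) => x /dom_n; rewrite /pdom /= => ->.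
  - by apply: (@ray_cofinite _ (pnat n)) => x /dom_n; exists x.
exists n, n; split=> [x|x /dom_n|]; last exact: leq_addr.
  by rewrite /pdom /= restr_ray1E; case: ifP.
by rewrite /pdom /= => ->.
Qed.

Definition IN_g_ray j n : IN_g j := SigSub (mem_set (IN_g_set_ray j n)).

(** Left multiplication by the ray identity cuts the domain of [g] down to its part in the ray, so
    it fixes [g] exactly when nothing is lost. *)
Lemma ray_mul_neqP j n (g : IN_g j) :
  (IN_g_ray j n * g)%g <> g <-> exists2 x, pdom (val g) x & pnat x < pnat n.
Proof.
split=> [neq|[x gx xn] /(congr1 (fun h : IN_g j => val h x)) /=].
  apply: contrapT => nex; apply: neq; apply/val_inj/funext => x /=.
  rewrite pcompE restr_ray1E; case: ifP => //= nx.
  case gx: (val g x) => [y|] //; case: nex.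
  by exists x; rewrite /pdom /= ?gx // ltnNge nx.
rewrite pcompE restr_ray1E leqNgt xn /= => gx0.
by move: gx; rewrite /pdom /= -gx0.
Qed.

Lemma mul_ray_neqP j n (g : IN_g j) :
  (g * IN_g_ray j n)%g <> g <-> exists2 y, pran (val g) y & pnat y < pnat n.
Proof.
split=> [neq|[y [x gx] yn] /(congr1 (fun h : IN_g j => val h x)) /=].
  apply: contrapT => nex; apply: neq; apply/val_inj/funext => x /=.
  rewrite pcompE; case gx: (val g x) => [y|] //=.
  rewrite restr_ray1E; case: ifP => // ny; case: nex.
  by exists y; [exists x|rewrite ltnNge ny].
by rewrite pcompE gx /= restr_ray1E leqNgt yn.
Qed.

(** The gap condition in usable form: [x] is at least the minimum of the domain, and the full ray
    starts at most [j] after that minimum. *)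
Lemma IN_g_ray_dom j (g : IN_g j) x y : pdom (val g) x ->
  pnat x + j <= pnat y -> pdom (val g) y.
Proof.
have Sg := set_valP g; have [a [b [amin bdom ab]]] := (IN_g_setP j Sg.1).1 Sg.
by move=> /amin ax xy; apply: bdom; lia.
Qed.

(** Each element translates its whole domain by one constant, which a single value determines. *)
Lemma IN_g_eq_shift j (g h : IN_g j) x0 x y z :
  val g x0 = Some z -> val h x0 = Some z ->
  val g x = Some y -> pdom (val h) x -> val h x = Some y.
Proof.
move=> gx0 hx0 gx; rewrite /pdom /=; case hx: (val h x) => [y'|] // _.
have [c [d cd]] := IN_infty_shift (set_valP g).1.
have [c' [d' cd']] := IN_infty_shift (set_valP h).1.
have := cd _ _ gx0; have := cd _ _ gx; have := cd' _ _ hx0; have := cd' _ _ hx.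
by move=> e1 e2 e3 e4; congr Some; apply: val_inj => /=; lia.
Qed.

(** Such an element is determined by its values on the integers from 1 to [n + j + 1], and these
    values are bounded. *)
Lemma finite_IN_g_bounded j n :
  finite_set [set g : IN_g j | (exists2 x, pdom (val g) x & pnat x < n) /\
                               (exists2 y, pran (val g) y & pnat y < n)].
Proof.
pose N := n + j.
(* Index [i] stands for the integer [i + 1]. [inord] loses nothing here, because [bound] below keeps
   the values in range. *)
pose table (g : IN_g j) : {ffun 'I_N.+1 -> option 'I_(N + n).+2} :=
  [ffun i : 'I_N.+1 => omap (fun y => inord (pnat y)) (val g (PosNat (ltn0Sn i)))].
suff /inj_card_eq/eq_finite_set <- : {in [set g : IN_g j |
    (exists2 x, pdom (val g) x & pnat x < n) /\
    (exists2 y, pran (val g) y & pnat y < n)] &, injective table}.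
  exact: finite_finset.
move=> g h /set_mem[domg rang] /set_mem[domh ranh] gh.
(* The shift of [k] is [y0 - x0], which is less than [n]. *)
have bound (k : IN_g j) x y : (exists2 y, pran (val k) y & pnat y < n) ->
    pnat x <= N.+1 -> val k x = Some y -> pnat y < (N + n).+2.
  move=> [y0 [x0 kx0] y0n] xN kx.
  have [c [d cd]] := IN_infty_shift (set_valP k).1.
  by have := cd _ _ kx0; have := cd _ _ kx; lia.
have low x : pnat x <= N.+1 -> val g x = val h x.
  move=> xN; have x0 : 0 < pnat x := pnat_gt0 x.
  have xN' : (pnat x).-1 < N.+1 by lia.
  have := congr1 (fun t : {ffun _ -> _} => t (Ordinal xN')) gh.
  rewrite !ffunE /=.
  have -> : PosNat (ltn0Sn (pnat x).-1) = x by apply: val_inj => /=; lia.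
  case gx: (val g x) => [y|]; case hx: (val h x) => [z|] //= [].
  move=> /(congr1 (@nat_of_ord _)); rewrite !inordK ?(bound _ _ _ _ xN gx) //.
    by move=> yz; congr Some; apply: val_inj.
  exact: bound hx.
have high (k : IN_g j) x : (exists2 x, pdom (val k) x & pnat x < n) ->
    N <= pnat x -> pdom (val k) x.
  by move=> [x0 kx0 x0n] Nx; apply: IN_g_ray_dom kx0 _; lia.
apply/val_inj/funext => x; have [/low //|Nx] := leqP (pnat x) N.+1.
(* The last tabulated integer, [N + 1], lies in both domains; the common value there forces equal
   shifts, hence agreement beyond the table. *)
pose m := PosNat (ltn0Sn N).
have gm : pdom (val g) m by apply: high => //=.
have := low m (leqnn _); move: gm; rewrite /pdom /=.
case gm: (val g m) => [z|] // _ /esym hm.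
have : pdom (val g) x by apply: high => //; lia.
rewrite /pdom /=; case gx: (val g x) => [y|] // _; apply/esym.
by apply: IN_g_eq_shift gm hm gx _; apply: high => //; lia.
Qed.

Theorem theorem3p2 (j : nat) (hj : 0 < j) (tau : Topological.axioms_ (IN_g j)) :
  hausdorff_topology tau -> shift_continuous tau -> discrete tau.
Proof.
move=> hT cT A; pose T : topologicalType := Topological.Pack tau.
suff open1 (g : T) : open [set g].
  have -> : A = \bigcup_(g in A) [set g] by rewrite bigcup_imset1 image_id.
  exact: bigcup_open.
have [x gx] := pdom_nonempty (set_valP (g : IN_g j)).1.
have [y gxy] : exists y, val (g : IN_g j) x = Some y.
  by move: gx; rewrite /pdom /=; case: (val _ x) => // y _; exists y.
(* Strictly above both [x] in the domain and [y] in the range, so that [g] belongs to the finite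
   open set. *)
pose n := PosNat (ltn0Sn (maxn (pnat x) (pnat y))).
pose e := IN_g_ray j n.
apply: (@open_finite_set1 T ([set h : T | (e * h)%g <> h] `&`
                             [set h : T | (h * e)%g <> h])).
- exact: hausdorff_accessible.
- have [ce ce'] := cT e; have cid : continuous (id : T -> T) by move=> h; exact: cvg_id.
  by apply: openI; [exact: (open_neq hT ce cid)|exact: (open_neq hT ce' cid)].
- apply: sub_finite_set (finite_IN_g_bounded j (pnat n)) => h [] /=.
  by move=> /ray_mul_neqP eh /mul_ray_neqP he.
- split; [apply/ray_mul_neqP|apply/mul_ray_neqP].
    by exists x => //=; rewrite ltnS leq_maxl.
  by exists y; [exists x|rewrite /= ltnS leq_maxr].
Qed.
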